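(* Let $k$ be a field, let $k^*$ denote the set of nonzero elements of $k$, and let $M$ be a tame matroid with ground set $E$. Then $M$ is a thin sums matroid over $k$ if and only if there are, for each circuit $o$ of $M$, a function $c_o\colon o\to k^*$ and, for each cocircuit $b$ of $M$, a function $d_b\colon b\to k^*$ such that for any circuit $o$ and any cocircuit $b$ of $M$ we have $$\sum_{e\in o\cap b}c_o(e)d_b(e)=0.$$
   Context: A matroid $M$ consists of a (possibly infinite) ground set $E$ and a set $\mathcal I$ of subsets of $E$ (the independent sets) such that: (I1) $\emptyset\in\mathcal I$; (I2) $\mathcal I$ is closed under taking subsets; (I3) for every non-maximal $I\in\mathcal I$ and every maximal $I'\in\mathcal I$ there is $x\in I'\setminus I$ with $I\cup\{x\}\in\mathcal I$; (IM) whenever $I\subseteq X\subseteq E$ and $I\in\mathcal I$, the set $\{I'\in\mathcal I : I\subseteq I'\subseteq X\}$ has a maximal element. Bases are maximal independent sets; circuits are minimal dependent (non-independent) sets. The dual $M^*$ is the matroid on $E$ whose bases are the complements of the bases of $M$; cocircuits of $M$ are circuits of $M^*$. A matroid is tame if the intersection of any circuit with any cocircuit is finite. Thin sums: for a set $A$ and a map $f\colon E\to k^A$, a thin dependence of $f$ is a map $c\colon E\to k$ such that for each $a\in A$ we have $\sum_{e\in E}c(e)f(e)(a)=0$ (including the requirement that, for each $a$, only finitely many summands are nonzero). The thin sums system $M_{ts}(f)$ is the set system on $E$ in which a subset is independent iff there is no nonzero thin dependence of $f$ that is zero outside that subset. A matroid $M$ on $E$ is a thin sums matroid over $k$ if $M=M_{ts}(f)$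 for some set $A$ and some $f\colon E\to k^A$. *)

(* Defs.v *)
From mathcomp Require Import all_boot all_order all_algebra finmap.
From mathcomp Require Import boolp classical_sets functions cardinality fsbigop.

Set Implicit Arguments.
Unset Strict Implicit.
Unset Printing Implicit Defensive.

Import GRing.Theory.
Local Open Scope classical_set_scope.
Local Open Scope ring_scope.

Definition maximal_set (E : Type) (F : set (set E)) (I : set E) : Prop :=
  F I /\ forall J, F J -> I `<=` J -> J = I.

Definition minimal_set (E : Type) (F : set (set E)) (I : set E) : Prop :=
  F I /\ forall J, F J -> J `<=` I -> J = I.

(* The ground set is the whole (possibly infinite, possibly empty) type E. *)
Record matroid (E : Type) := Matroid {
  indep : set (set E);
  indep_set0 : indep set0;
  indep_sub : forall I J, indep J -> I `<=` J -> indep I;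
  indep_aug : forall I I', indep I -> ~ maximal_set indep I ->
    maximal_set indep I' ->
    exists2 x, (I' `\` I) x & indep (I `|` [set x]);
  indep_max : forall I X, indep I -> I `<=` X ->
    exists J, maximal_set [set I' | indep I' /\ I `<=` I' /\ I' `<=` X] J
}.

Definition base (E : Type) (M : matroid E) (B : set E) : Prop :=
  maximal_set (indep M) B.

Definition circuit (E : Type) (M : matroid E) (o : set E) : Prop :=
  minimal_set [set D | ~ indep M D] o.

Section Dual.
Variables (E : Type) (M : matroid E).

Definition dual_indep : set (set E) :=
  [set J | exists2 B, base M B & J `<=` ~` B].

Lemma ex_base_above_in (I X B : set E) :
    indep M I -> I `<=` X -> base M B -> B `<=` X ->
  exists2 B', base M B' & I `<=` B' /\ B' `<=` X.
Proof.
move=> iI IX bB BX; have [J [[iJ [IJ JX]] Jmax]] := indep_max iI IX.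
exists J => //; apply: contrapT => nbJ.
have [x [Bx nJx] iJx] := indep_aug iJ nbJ bB.
apply: nJx; rewrite -(Jmax (J `|` [set x])); first by right.
- split=> //; split=> [y /IJ ?|y [/JX //|->]]; [by left|exact: BX].
- by move=> y ?; left.
Qed.

Lemma maximal_dual_indep (B : set E) :
  maximal_set dual_indep B <-> base M (~` B).
Proof.
split=> [[[C bC BC] Bmax]|bB].
  suff <- : ~` C = B by rewrite setCK.
  by apply: Bmax BC; exists C.
split=> [|J [C bC JC] BJ]; first by exists (~` B) => //; rewrite setCK.
have CB : C `<=` ~` B by move=> x Cx /BJ /JC.
have eqC : ~` B = C by case: bC => _; apply=> //; case: bB.
by apply/seteqP; split=> // x /JC; rewrite -eqC setCK.
Qed.

Lemma dual_indep_set0 : dual_indep set0.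
Proof.
have [B [[iB _] Bmax]] := indep_max (@indep_set0 _ M) (@sub0set _ setT).
by exists B => //; split=> // J iJ; apply: Bmax; split=> //; split.
Qed.

Lemma dual_indep_sub (I J : set E) : dual_indep J -> I `<=` J -> dual_indep I.
Proof. by move=> [B bB JB] IJ; exists B => // x /IJ /JB. Qed.

Lemma dual_indep_aug (J J' : set E) :
    dual_indep J -> ~ maximal_set dual_indep J -> maximal_set dual_indep J' ->
  exists2 x, (J' `\` J) x & dual_indep (J `|` [set x]).
Proof.
move=> [B bB JB] nmJ /maximal_dual_indep bJ'.
have iI : indep M (~` J' `&` ~` J).
  by case: bJ' => iJ' _; apply: indep_sub iJ' _ => x [].
have [||C bC [IC CJ]] := ex_base_above_in iI (X := ~` J) _ bB.
- by move=> x [].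
- by move=> x Bx /JB.
have [x [nJx nCx]] : exists x, ~ J x /\ ~ C x.
  apply: contrapT => nex; apply: nmJ; apply/maximal_dual_indep.
  suff <- : C = ~` J by [].
  apply/seteqP; split=> // x nJx; apply: contrapT => nCx.
  by apply: nex; exists x.
exists x; first by split=> //; apply: contrapT => nJ'x; apply/nCx/IC.
by exists C => // y [Jy /CJ|->].
Qed.

Lemma dual_indep_max (I X : set E) : dual_indep I -> I `<=` X ->
  exists J,
    maximal_set [set I' | dual_indep I' /\ I `<=` I' /\ I' `<=` X] J.
Proof.
move=> [B bB IB] IX.
have [S [[iS [_ SX]] Smax]] := indep_max (@indep_set0 _ M) (@sub0set _ (~` X)).
have [||C bC [SC CI]] := ex_base_above_in iS (X := ~` I) _ bB.
- by move=> x /SX nXx /IX.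
- by move=> x Bx /IB.
exists (X `\` C); split.
  split; first by exists C => // x [].
  by split=> [x Ix|x []//]; split; [exact: IX|move=> /CI].
move=> J [[D bD JD] [IJ JX]] XJ; apply/seteqP; split=> // x Jx.
split; first exact: JX.
move=> Cx; have iC' : indep M (C `&` ~` J).
  by case: bC => iC _; apply: indep_sub iC _ => y [].
have nbC' : ~ base M (C `&` ~` J).
  move=> [_ C'max]; have eqC : C = C `&` ~` J.
    by apply: C'max; [case: bC|move=> y []].
  by move: Cx; rewrite eqC => -[].
have [y [Dy nC'y] iC'y] := indep_aug iC' nbC' bD.
have nJy : ~ J y by move=> /JD.
have nCy : ~ C y by move=> Cy; apply: nC'y.
have nXy : ~ X y by move=> Xy; apply/nJy/XJ.
apply/nCy/SC; rewrite -(Smax (S `|` [set y])); first by right.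
- split; last by split=> [//|z [/SX//|->]].
  apply: indep_sub iC'y _ => z [Sz|->]; last by right.
  by left; split; [exact: SC|move=> /JX; exact: SX].
- by move=> z ?; left.
Qed.

Definition dual : matroid E :=
  Matroid dual_indep_set0 dual_indep_sub dual_indep_aug dual_indep_max.

Lemma base_dual (B : set E) : base dual B <-> base M (~` B).
Proof. exact: maximal_dual_indep. Qed.

End Dual.

Definition cocircuit (E : Type) (M : matroid E) (b : set E) : Prop :=
  circuit (dual M) b.

Definition tame (E : Type) (M : matroid E) : Prop :=
  forall o b, circuit M o -> cocircuit M b -> finite_set (o `&` b).

(* The sum \sum_(e \in D) F e is 0 by convention when F has infinite support,
   hence the separate finiteness requirement. *)
Definition thin_dependence (k : fieldType) (E : choiceType) (A : Type)
    (f : E -> A -> k) (c : E -> k) : Prop :=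
  forall a, finite_set [set e | c e * f e a != 0] /\
            \sum_(e \in [set: E]) c e * f e a = 0.

Definition thin_sums_system (k : fieldType) (E : choiceType) (A : Type)
    (f : E -> A -> k) : set (set E) :=
  [set I | ~ exists c : E -> k, [/\ thin_dependence f c,
                                    exists e, c e != 0 &
                                    forall e, ~ I e -> c e = 0]].

Definition thin_sums_matroid (k : fieldType) (E : choiceType)
    (M : matroid E) : Prop :=
  exists (A : Type) (f : E -> A -> k), indep M = thin_sums_system f.

(* Main.v *)
Require Import Defs.
From mathcomp Require Import all_boot all_order all_algebra finmap.
From mathcomp Require Import boolp classical_sets functions cardinality fsbigop.

Set Implicit Arguments.
Unset Strict Implicit.
Unset Printing Implicit Defensive.

Import GRing.Theory.
Local Open Scope classical_set_scope.
Local Open Scope ring_scope.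

(** Given the functions [c] and [d], represent each element by its values
under all [d b], extended by zero.  The [c o] are then thin dependences
supported on the circuits, and there is no nonzero thin dependence on an
independent set, because fundamental cocircuits detect its values one at a
time ([thin_sums_of_orthogonal]).

Conversely, let [M] be the thin sums system of [f].  Each circuit [o] is the
support of a thin dependence [c o] ([circuit_dependence]).  For a cocircuit
[b], the function [d b] is determined up to a scalar by orthogonality to the
circuits that meet [b] in two elements, and there are enough of these: the
fundamental circuits with respect to a base meeting [b] in one element.  To
reach an arbitrary circuit, one cancels its dependence on all of [b] but one
element [e0], with the help of these fundamental circuits, and has to know
that the result vanishes at [e0] too ([cocircuit_orthogonal]).

This is clear if the support of the result is a circuit, since a circuit and a
cocircuit never meet in one element ([circuit_cocircuit_meet]).  In general a
further reduction, to a dependence with independent support, is required,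
which may take infinitely many subtractions.  They can be carried out together
since, by tameness, the support meets every cocircuit in a finite set
([dependence_cocircuit]). *)

(** * Circuits and cocircuits of infinite matroids *)

Section Circuits.
Variables (E : Type) (M : matroid E).

Lemma ex_base_above (I : set E) :
  indep M I -> exists2 B, base M B & I `<=` B.
Proof.
move=> iI; have [B [[iB [IB _]] Bmax]] := indep_max iI (@subsetT _ I).
exists B => //; split=> // J iJ BJ; apply: Bmax => //.
by split=> //; split=> //; apply: subset_trans BJ.
Qed.

Lemma circuit_dependent (o : set E) : circuit M o -> ~ indep M o.
Proof. by case. Qed.

Lemma circuitD1_indep (o : set E) (e : E) :
  circuit M o -> o e -> indep M (o `\ e).
Proof.
move=> [_ omin] oe; apply: contrapT => doe.
by have oE := omin _ doe (@subDsetl _ _ _); move: oe; rewrite -oE => -[_]; apply.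
Qed.

(** The circuit consists of the elements that can be exchanged for [x] in a
base [B] above [I].  It is dependent because a base between it and [B + x]
would miss some [z] in [B], and augmenting [B - z] from that base would make
[z] one of the exchangeable elements. *)
Lemma fundamental_circuit (I : set E) (x : E) :
    indep M I -> ~ indep M (I `|` [set x]) ->
  exists2 o, circuit M o & o x /\ o `<=` I `|` [set x].
Proof.
move=> iI dIx; have [B bB IB] := ex_base_above iI.
have dBx : ~ indep M (B `|` [set x]).
  by move=> iBx; apply: dIx; apply: indep_sub iBx _; apply: setSU.
have nBx : ~ B x.
  move=> Bx; apply: dBx; apply: indep_sub (proj1 bB) _.
  by move=> y [//|->].
pose o := [set y | (B `|` [set x]) y /\ indep M ((B `|` [set x]) `\ y)].
have ox : o x.
  split; first by right.
  by apply: indep_sub (proj1 bB) _ => y [[]].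
exists o; last first.
  split=> // y [_ iy]; apply: contrapT => nIxy; apply: dIx.
  apply: indep_sub iy _ => z Iz; split.
    by case: Iz => [/IB|]; [left|right].
  by move=> zy; apply: nIxy; rewrite -zy.
split=> [io|J dJ Jo].
  have [||B' bB' [oB' B'x]] := ex_base_above_in io (X := B `|` [set x]) _ bB.
  - by move=> y [].
  - by move=> y; left.
  have [z Bz nB'z] : exists2 z, B z & ~ B' z.
    apply: contrapT => nex; apply: dBx; apply: indep_sub (proj1 bB') _.
    move=> z [Bz|->]; last exact: oB'.
    by apply: contrapT => nB'z; apply: nex; exists z.
  have iBz : indep M (B `\ z) by apply: indep_sub (proj1 bB) _; apply: subDsetl.
  have nbBz : ~ maximal_set (indep M) (B `\ z).
    move=> [_ /(_ _ (proj1 bB) (@subDsetl _ _ _)) BE].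
    by move: Bz; rewrite BE => -[_]; apply.
  have [y [B'y nBzy] iy] := indep_aug iBz nbBz bB'.
  have yx : y = x.
    case: (B'x _ B'y) => [By|//]; exfalso; apply: nBzy; split=> // yz.
    by apply: nB'z; rewrite -yz.
  apply/nB'z/oB'; split; first by left.
  by apply: indep_sub iy _; rewrite yx => w [[Bw|->] wz]; [left|right].
apply/seteqP; split=> // y oy; apply: contrapT => nJy; apply: dJ.
case: oy => _ iy; apply: indep_sub iy _ => z Jz; split.
  by case: (Jo _ Jz).
by move=> zy; apply: nJy; rewrite -zy.
Qed.

Lemma ex_circuit (D : set E) :
  ~ indep M D -> exists2 o, circuit M o & o `<=` D.
Proof.
move=> dD.
have [J [[iJ [_ JD]] Jmax]] := indep_max (@indep_set0 _ M) (@sub0set _ D).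
have [x Dx nJx] : exists2 x, D x & ~ J x.
  apply: contrapT => nex; apply: dD; apply: indep_sub iJ _ => x Dx.
  by apply: contrapT => nJx; apply: nex; exists x.
have JxD : J `|` [set x] `<=` D by move=> y [/JD|->].
have [iJx|o co [_ oJx]] := fundamental_circuit iJ (x := x).
  apply: nJx; rewrite -(Jmax (J `|` [set x])); first by right.
    by split=> //; split=> [y []|].
  by move=> y; left.
by exists o => //; apply: subset_trans JxD.
Qed.

End Circuits.

Section Cocircuits.
Variables (E : Type) (M : matroid E).

Lemma fundamental_cocircuit (B : set E) (x : E) : base M B -> B x ->
  exists2 b, cocircuit M b & b x /\ b `<=` ~` B `|` [set x].
Proof.
move=> bB Bx; apply: (@fundamental_circuit _ (dual M)).
  by exists B.
move=> [C bC BxC].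
have CB : C `<=` B.
  by move=> y Cy; apply: contrapT => nBy; apply: (BxC y) => //; left.
have BC : B = C by apply: (proj2 bC) CB; case: bB.
by apply: (BxC x); [right|rewrite -BC].
Qed.

(** If [o] and [b] met in [e] only, then there would be a base [B] above
[o - e] that avoids [b - e]; it contains the dependent set [o] or avoids the
codependent set [b], according to whether it contains [e]. *)
Lemma circuit_cocircuit_meet (o b : set E) (e : E) :
    circuit M o -> cocircuit M b -> o e -> b e ->
  exists2 x, x <> e & o x /\ b x.
Proof.
move=> co cb oe be; apply: contrapT => nex.
have iob := circuitD1_indep co oe.
have [C bC beC] := circuitD1_indep cb be.
have [||B bB [oB Bb]] := ex_base_above_in iob (X := ~` (b `\ e)) _ bC.
- by move=> x [ox xe] [bx _]; apply: nex; exists x.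
- by move=> x Cx /beC.
have [Be|nBe] := pselect (B e).
  apply: (circuit_dependent co); apply: indep_sub (proj1 bB) _ => x ox.
  by have [->//|xe] := pselect (x = e); apply: oB.
case: cb => + _; apply; exists B => // x bx Bx.
by apply: (Bb x Bx); split=> // xe; apply: nBe; rewrite -xe.
Qed.

Lemma cocircuit_base (b : set E) (e : E) : cocircuit M b -> b e ->
  exists2 B, base M B & forall x, b x -> B x -> x = e.
Proof.
move=> cb be; have [B bB beB] := circuitD1_indep cb be.
exists B => // x bx Bx; apply: contrapT => xe.
exact: (beB x).
Qed.

Lemma cocircuit_nonempty (b : set E) : cocircuit M b -> exists e, b e.
Proof.
move=> [db _]; apply: contrapT => nex; apply: db.
have -> : b = set0 by apply/seteqP; split=> // e be; apply: nex; exists e.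
exact: dual_indep_set0.
Qed.

End Cocircuits.

(** * Thin dependences *)

Section ThinDependences.
Variables (k : fieldType) (E : choiceType) (A : Type) (f : E -> A -> k).

Implicit Types (c : E -> k) (D : set E).

(** A sum of infinitely many thin dependences is one too, provided that each
coordinate sees only finitely many of them.  At an element [e] with [f e = 0]
the sum may have infinitely many terms, but there its value is irrelevant. *)
Lemma thin_dependence_sum (D : set E) (g : E -> E -> k) :
    (forall s, D s -> thin_dependence f (g s)) ->
    (forall a, finite_set [set s | D s /\ exists e, g s e * f e a != 0]) ->
  thin_dependence f (fun e => \sum_(s \in D) g s e).
Proof.
move=> Dg fin a.
pose T := [set s | D s /\ exists e, g s e * f e a != 0].
have finT : finite_set T := fin a.
have sumT e : (\sum_(s \in D) g s e) * f e a = \sum_(s \in T) g s e * f e a.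
  rewrite mulr_fsuml; apply/esym/fsbig_widen => [s []//|s [Ds nTs]].
  by apply: contrapT => /eqP nz; apply: nTs; split=> //; exists e.
pose F := \bigcup_(s in T) [set e | g s e * f e a != 0].
have finF : finite_set F.
  by apply: bigcup_finite => // s [Ds _]; case: (Dg s Ds a).
have supp e : (\sum_(s \in D) g s e) * f e a != 0 -> F e.
  rewrite sumT => /eqP nz; apply: contrapT => nFe; apply: nz.
  by apply: fsbig1 => s Ts; apply: contrapT => /eqP nz; apply: nFe; exists s.
split; first exact: sub_finite_set finF.
rewrite -(fsbig_widen F) //; last first.
  by move=> e [_ nFe]; apply: contrapT => /eqP/supp.
under eq_fsbigr do rewrite sumT.
rewrite exchange_fsbig // fsbig1 // => s Ts.
rewrite -[RHS](proj2 (Dg s (proj1 Ts) a)).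
apply: fsbig_widen => // e [_ nFe]; apply: contrapT => /eqP nz.
by apply: nFe; exists s.
Qed.

Lemma thin_dependenceZ c x :
  thin_dependence f c -> thin_dependence f (fun e => x * c e).
Proof.
move=> tc a; have [fin sum0] := tc a; split.
  apply: sub_finite_set fin => e /=; rewrite -mulrA.
  by rewrite mulf_eq0 negb_or => /andP[].
by under eq_fsbigr do rewrite -mulrA; rewrite -mulr_fsumr sum0 mulr0.
Qed.

Lemma thin_dependenceB c c' : thin_dependence f c -> thin_dependence f c' ->
  thin_dependence f (fun e => c e - c' e).
Proof.
move=> tc tc' a; have [fin sum0] := tc a; have [fin' sum0'] := tc' a.
pose F := [set e | c e * f e a != 0] `|` [set e | c' e * f e a != 0].
have finF : finite_set F by rewrite finite_setU.
have out e : ~ F e -> c e * f e a = 0 /\ c' e * f e a = 0.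
  by move=> nF; split; apply: contrapT => /eqP nz; apply: nF; [left|right].
have outB e : ~ F e -> (c e - c' e) * f e a = 0.
  by move=> /out[z z']; rewrite mulrBl z z' subr0.
split.
  by apply: sub_finite_set finF => e /= nz; apply: contrapT => /outB /eqP;
    apply/negP.
have widen (h : E -> k) : (forall e, ~ F e -> h e = 0) ->
    \sum_(e \in [set: E]) h e = \sum_(e \in F) h e.
  by move=> h0; apply/esym/fsbig_widen => // e [_ /h0].
rewrite (widen _ outB); under eq_fsbigr do rewrite mulrBl -mulN1r.
rewrite fsbig_split //= -mulr_fsumr.
by rewrite -!widen ?sum0 ?sum0' ?mulr0 ?addr0 // => e /out[].
Qed.

End ThinDependences.

(** * Dependences and cocircuits in a tame thin sums matroid *)

Section TameThinSums.
Variables (k : fieldType) (E : choiceType) (M : matroid E) (A : Type).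
Variables (f : E -> A -> k) (tameM : tame M).
Hypothesis indepE : indep M = thin_sums_system f.

Lemma indep_dependence (I : set E) (c : E -> k) (e : E) :
    indep M I -> thin_dependence f c -> (forall x, ~ I x -> c x = 0) ->
  c e = 0.
Proof.
rewrite indepE => nI tc c0; apply: contrapT => /eqP nz; apply: nI.
by exists c; split=> //; exists e.
Qed.

Lemma circuit_dependence (o : set E) : circuit M o ->
  exists g, thin_dependence f g /\ forall e, (g e != 0) = (o e) :> Prop.
Proof.
move=> co; have := circuit_dependent co.
rewrite indepE => /contrapT[g [tg [x gx] g0]].
exists g; split=> // e; apply/propext; split=> [|oe].
  by apply: contraPP => /g0 ->; rewrite eqxx.
apply/negP => /eqP ge0; have := circuitD1_indep co oe.
move=> /indep_dependence /(_ tg) => g_eq0; move/negP: gx; apply; apply/eqP.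
apply: g_eq0 => y noy; have [->//|ye] := pselect (y = e).
by apply: g0 => oy; apply: noy.
Qed.

(** Suppose that [c e <> 0], and let [J] be a maximal independent subset of
[S], the support of [c], with [e] in [J].  Each [s] in [S - J] lies on a
circuit inside [J + s], and this circuit avoids [e], since otherwise it would
meet [b] in [e] only.  Subtracting from [c] the multiple of that circuit's
dependence that cancels the value at [s], for all [s] at once, leaves a
dependence supported on the independent set [J] with value [c e] at [e].

The subtracted sum is legitimate since each [i] in [J] lies on finitely many
of these circuits: all the [s] involved belong to the fundamental cocircuit
of [i] with respect to a base above [J], which meets [S] in a finite set.
Moreover the thinness of [c] leaves only finitely many elements of [S] visible
to a given coordinate. *)
Lemma dependence_cocircuit (c : E -> k) (b : set E) (e : E) :
    thin_dependence f c ->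
    (forall b', cocircuit M b' -> finite_set ([set x | c x != 0] `&` b')) ->
    cocircuit M b -> b e -> (forall x, b x -> x <> e -> c x = 0) ->
  c e = 0.
Proof.
move=> tc finS cb be c0; apply: contrapT => /eqP ce.
pose S := [set x | c x != 0].
have offe o : circuit M o -> o `<=` S -> ~ o e.
  move=> co oS oe; have [x xe [ox bx]] := circuit_cocircuit_meet co cb oe be.
  by have := oS _ ox; rewrite /S /= (c0 x bx xe) eqxx.
have eS : [set e] `<=` S by move=> x ->.
have ie : indep M [set e].
  apply: contrapT => /ex_circuit[o co oe]; apply: (offe o co).
    exact: subset_trans eS.
  apply: contrapT => noe; apply: (circuit_dependent co).
  apply: indep_sub (@indep_set0 _ M) _ => x ox; apply: noe.
  by have <- := oe _ ox.
have [J [[iJ [/(_ e erefl) Je JS]] Jmax]] := indep_max ie eS.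
have [B bB JB] := ex_base_above iJ.
have /choice[h hP] s : exists g : E -> k, (S `\` J) s ->
    [/\ thin_dependence f g, g s != 0,
        circuit M [set x | g x != 0] &
        [set x | g x != 0] `<=` J `|` [set s]].
  have [[Ss nJs]|nD] := pselect ((S `\` J) s); last by exists (fun=> 0).
  have dJs : ~ indep M (J `|` [set s]).
    move=> iJs; apply: nJs; rewrite -(Jmax (J `|` [set s])); first by right.
      split=> //; split=> [x ->|x [/JS//|->//]]; by left.
    by move=> x; left.
  have [o co [os oJs]] := fundamental_circuit iJ dJs.
  have [g [tg gE]] := circuit_dependence co; exists g => _.
  have gset : [set x | g x != 0] = o.
    by apply/seteqP; split=> x /=; rewrite gE.
  by rewrite gset; split=> //; rewrite gE.
pose g s x := c s / h s s * h s x.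
have gS s x : (S `\` J) s -> g s x != 0 -> S x.
  move=> Ds; rewrite mulf_eq0 negb_or => /andP[_ hx].
  have [_ _ _ /(_ x hx)] := hP s Ds; case=> [/JS//|->]; by case: Ds.
have gJ s x : (S `\` J) s -> ~ J x -> x <> s -> g s x = 0.
  move=> Ds nJx xs; apply: contrapT => /eqP.
  rewrite mulf_eq0 negb_or => /andP[_ hx].
  by have [_ _ _ /(_ x hx)] := hP s Ds; case.
have finJ i : S i -> finite_set [set s | (S `\` J) s /\ g s i != 0].
  move=> Si; have [Ji|nJi] := pselect (J i); last first.
    apply: sub_finite_set (finite_set1 i) => s [Ds nz].
    by apply: contrapT => si; move: nz; rewrite (gJ s i) ?eqxx // => /esym.
  have [b' cb' [b'i b'B]] := fundamental_cocircuit bB (JB _ Ji).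
  apply: sub_finite_set (finS _ cb') => s [Ds].
  rewrite mulf_eq0 negb_or => /andP[_ hi]; have [_ _ co oJs] := hP s Ds.
  split; first by case: Ds.
  have [x xi [hx b'x]] := circuit_cocircuit_meet co cb' hi b'i.
  case: (oJs _ hx) => [/JB Bx|<-//]; by case: (b'B _ b'x).
pose c' x := c x - \sum_(s \in S `\` J) g s x.
have tc' : thin_dependence f c'.
  apply: thin_dependenceB => //; apply: thin_dependence_sum => [s Ds|a].
    by apply: thin_dependenceZ; case: (hP s Ds).
  have [finF _] := tc a.
  apply: (@sub_finite_set _ _ (\bigcup_(i in [set x | c x * f x a != 0])
      [set s | (S `\` J) s /\ g s i != 0])).
    move=> s [Ds [x]]; rewrite mulf_eq0 negb_or => /andP[gx fx].
    by exists x => //=; rewrite mulf_neq0 //; apply: gS gx.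
  apply: bigcup_finite => // i /=; rewrite mulf_eq0 negb_or => /andP[ci _].
  exact: finJ.
have c'J x : ~ J x -> c' x = 0.
  move=> nJx; rewrite /c'; have [Sx|nSx] := pselect (S x); last first.
    rewrite fsbig1 ?subr0; first by apply: contrapT => /eqP.
    by move=> s Ds; apply: contrapT => /eqP/(gS _ _ Ds).
  rewrite -(fsbig_widen [set x]) ?fsbig_set1.
  - have [_ hx _ _] := hP x (conj Sx nJx).
    by rewrite /g divfK // subrr.
  - by move=> s ->.
  - by move=> s [Ds sx]; apply: gJ => // xs; apply: sx.
have c'e : c' e = c e.
  rewrite /c' fsbig1 ?subr0 // => s Ds; apply: contrapT => /eqP.
  rewrite mulf_eq0 negb_or => /andP[_ he]; have [_ _ co oJs] := hP s Ds.
  by apply: (offe _ co) => // x /oJs[/JS//|->]; case: Ds.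
by move/eqP: ce; apply; rewrite -c'e; apply: indep_dependence iJ tc' c'J.
Qed.

(** Fix [e0] in [b] and a base [B] that meets [b] in [e0] only.  The
fundamental circuit of any other [e] in [b] meets [b] in exactly [e0] and [e],
so orthogonality to it forces [d e] up to the normalization [d e0 = 1].
From the dependence of an arbitrary circuit [o], subtract the multiples of
those of the fundamental circuits of the elements of [o] in [b - e0] that
cancel it there.  By tameness there are finitely many such elements, so the
support of the result still meets every cocircuit in a finite set.  It
vanishes on [b - e0], hence at [e0] by [dependence_cocircuit], and its value
at [e0] is the required sum. *)
Lemma cocircuit_orthogonal (c : set E -> E -> k) (b : set E) :
    (forall o, circuit M o ->
       thin_dependence f (c o) /\ forall e, (c o e != 0) = (o e) :> Prop) ->
    cocircuit M b ->
  exists d : E -> k, (forall e, b e -> d e != 0) /\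
    forall o, circuit M o -> \sum_(e \in o `&` b) c o e * d e = 0.
Proof.
move=> cP cb; have [e0 be0] := cocircuit_nonempty cb.
have [B bB Bb] := cocircuit_base cb be0.
have /choice[h hP] s : exists o, (b `\ e0) s ->
    [/\ circuit M o, o s, o e0 & forall x, b x -> o x -> x = s \/ x = e0].
  have [[bs se0]|nD] := pselect ((b `\ e0) s); last by exists set0.
  have dBs : ~ indep M (B `|` [set s]).
    move=> /(proj2 bB) BE; apply/se0/(Bb s bs); rewrite -BE; first by right.
    by move=> x; left.
  have [o co [os oB]] := fundamental_circuit (proj1 bB) dBs.
  have ob x : b x -> o x -> x = s \/ x = e0.
    by move=> bx /oB[Bx|->]; [right; apply: Bb|left].
  exists o => _; split=> //.
  have [x xs [ox bx]] := circuit_cocircuit_meet co cb os bs.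
  by case: (ob x bx ox) => // <-.
have cN0 o e : circuit M o -> o e -> c o e != 0.
  by move=> /cP[_ cE]; rewrite cE.
have c0 o e : circuit M o -> ~ o e -> c o e = 0.
  by move=> /cP[_ cE] noe; apply: contrapT => /eqP; rewrite cE.
pose d e := if e == e0 then 1 else - (c (h e) e0 / c (h e) e).
exists d; split=> [e be|o co].
  rewrite /d; case: (e =P e0) => [_|ee0]; first exact: oner_neq0.
  have [ch he he0 _] := hP e (conj be ee0).
  by rewrite oppr_eq0 mulf_neq0 ?invr_eq0 //; apply: cN0.
pose D := (o `&` b) `\ e0.
have finob : finite_set (o `&` b) by apply: tameM.
have finD : finite_set D by apply: sub_finite_set finob; apply: subDsetl.
have Db s : D s -> (b `\ e0) s by move=> [[]].
pose g s x := c o s / c (h s) s * c (h s) x.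
have gh s x : D s -> g s x != 0 -> h s x.
  move=> /Db /hP[ch _ _ _]; rewrite mulf_eq0 negb_or => /andP[_].
  by have [_ ->] := cP _ ch.
pose c' x := c o x - \sum_(s \in D) g s x.
have tc' : thin_dependence f c'.
  apply: thin_dependenceB; first by case: (cP o co).
  apply: thin_dependence_sum => [s /Db /hP[ch _ _ _]|a].
    by apply: thin_dependenceZ; case: (cP _ ch).
  by apply: sub_finite_set finD => s [].
have c'S x : c' x != 0 -> (o `|` \bigcup_(s in D) h s) x.
  move=> nz; apply: contrapT => nx; move: nz; rewrite /c' c0 //; last first.
    by move=> ox; apply: nx; left.
  rewrite fsbig1 ?subrr ?eqxx // => s Ds.
  apply: contrapT => /eqP /(gh _ _ Ds) hx.
  by apply: nx; right; exists s.
have fin' b' : cocircuit M b' -> finite_set ([set x | c' x != 0] `&` b').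
  move=> cb'; apply: (@sub_finite_set _ _
      ((o `&` b') `|` \bigcup_(s in D) (h s `&` b'))).
    by move=> x [/c'S[ox|[s Ds hx]] b'x]; [left|right; exists s].
  rewrite finite_setU; split; first exact: tameM.
  by apply: bigcup_finite => // s /Db /hP[ch _ _ _]; apply: tameM.
have c'b x : b x -> x <> e0 -> c' x = 0.
  move=> bx xe0; have gx s : D s -> x <> s -> g s x = 0.
    move=> Ds xs; apply: contrapT => /eqP /(gh _ _ Ds) hx.
    by have [_ _ _ /(_ x bx hx)] := hP s (Db s Ds); case.
  rewrite /c'; have [Dx|nDx] := pselect (D x).
    rewrite -(fsbig_widen [set x]) ?fsbig_set1.
    - have [ch hx _ _] := hP x (Db x Dx).
      by rewrite /g divfK ?subrr //; apply: cN0.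
    - by move=> s ->.
    - by move=> s [Ds sx]; apply: gx => // xs; apply: sx.
  rewrite c0 // => [|ox]; last by apply: nDx.
  rewrite fsbig1 ?subr0 // => s Ds; apply: gx => // xs.
  by apply: nDx; rewrite xs.
have := dependence_cocircuit tc' fin' cb be0 c'b.
have sumE : \sum_(e \in D) c o e * d e = - \sum_(s \in D) g s e0.
  rewrite -mulN1r mulr_fsumr; apply: eq_fsbigr => s.
  rewrite inE => -[_ /eqP se0].
  by rewrite /d (negbTE se0) /g mulN1r mulrN mulrA mulrAC.
have -> : \sum_(e \in o `&` b) c o e * d e = c' e0; last by [].
rewrite /c' -sumE; have [oe0|noe0] := pselect (o e0).
  by rewrite (fsbigD1 e0) //= /d eqxx mulr1.
rewrite c0 // add0r; congr (\big[_/_]_(_ \in _) _); apply/seteqP.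
by split=> [x obx|x []//]; split=> // xe0; apply: noe0; rewrite -xe0; case: obx.
Qed.

End TameThinSums.

(** The coordinates of the family [f] to take are the functions [d b], extended
by zero, so that the [c o] are thin dependences by hypothesis.  Conversely, a
nonzero thin dependence has no independent support: the fundamental
cocircuit of a point [e] of the support, with respect to a base above this
independent set, would see the single nonzero term at [e]. *)
Lemma thin_sums_of_orthogonal (k : fieldType) (E : choiceType) (M : matroid E)
    (c d : set E -> E -> k) :
    tame M ->
    (forall o, circuit M o -> forall e, o e -> c o e != 0) ->
    (forall b, cocircuit M b -> forall e, b e -> d b e != 0) ->
    (forall o b, circuit M o -> cocircuit M b ->
       \sum_(e \in o `&` b) c o e * d b e = 0) ->
  thin_sums_matroid k M.
Proof.
move=> tameM cN0 dN0 cd.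
pose ext (D : set E) (h : E -> k) e := if `[< D e >] then h e else 0.
have extT D h e : D e -> ext D h e = h e.
  by move=> De; rewrite /ext asboolT.
have extF D h e : ~ D e -> ext D h e = 0.
  by move=> De; rewrite /ext asboolF.
exists {b | cocircuit M b}, (fun e b => ext (sval b) (d (sval b)) e).
apply/seteqP; split=> [I iI [v [tv [e ve] vI]]|I nI].
  have [B bB IB] := ex_base_above iI.
  have Ie : I e by apply: contrapT => /vI v0; rewrite v0 eqxx in ve.
  have [b cb [be bB']] := fundamental_cocircuit bB (IB _ Ie).
  have [_] := tv (exist _ b cb); rewrite /= -(fsbig_widen [set e]) //.
    rewrite fsbig_set1 extT // => /eqP; apply/negP.
    by rewrite mulf_neq0 //; apply: dN0.
  move=> x [_ xe] /=; have [bx|nbx] := pselect (b x); last first.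
    by rewrite extF // mulr0.
  by rewrite vI ?mul0r // => /IB Bx; case: (bB' x bx).
apply: contrapT => /ex_circuit[o co oI]; apply: nI; exists (ext o (c o)); split.
- move=> [b cb] /=.
  have out e : ~ (o `&` b) e -> ext o (c o) e * ext b (d b) e = 0.
    move=> nob; have [oe|noe] := pselect (o e); last by rewrite extF ?mul0r.
    by rewrite [X in _ * X]extF ?mulr0 // => be; apply: nob.
  split.
    apply: sub_finite_set (tameM _ _ co cb) => e /= nz.
    by apply: contrapT => /out /eqP; apply/negP.
  rewrite -(fsbig_widen (o `&` b)) // => [|e [_ /out]//].
  rewrite -[RHS](cd o b co cb); apply: eq_fsbigr => e.
  by rewrite inE => -[oe be]; rewrite !extT.
- have [e oe] : exists e, o e.
    apply: contrapT => nex; apply: (circuit_dependent co).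
    by apply: indep_sub (@indep_set0 _ M) _ => e oe; apply: nex; exists e.
  by exists e; rewrite extT //; apply: cN0.
- by move=> e nIe; apply: extF => /oI.
Qed.

Theorem lemma6p2 (k : fieldType) (E : choiceType) (M : matroid E)
    (tameM : tame M) :
  thin_sums_matroid k M <->
  exists c d : set E -> E -> k,
    [/\ forall o, circuit M o -> forall e, o e -> c o e != 0,
        forall b, cocircuit M b -> forall e, b e -> d b e != 0 &
        forall o b, circuit M o -> cocircuit M b ->
          \sum_(e \in o `&` b) c o e * d b e = 0].
Proof.
split=> [[A [f indepE]]|[c [d [cN0 dN0 cd]]]]; last first.
  exact: (thin_sums_of_orthogonal tameM cN0 dN0 cd).
have /choice[c cP] o : exists g : E -> k, circuit M o ->
    thin_dependence f g /\ forall e, (g e != 0) = (o e) :> Prop.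
  have [co|nco] := pselect (circuit M o); last by exists (fun=> 0).
  by have [g gP] := circuit_dependence indepE co; exists g.
have /choice[d dP] b : exists d : E -> k, cocircuit M b ->
    (forall e, b e -> d e != 0) /\
    forall o, circuit M o -> \sum_(e \in o `&` b) c o e * d e = 0.
  have [cb|ncb] := pselect (cocircuit M b); last by exists (fun=> 0).
  by have [d dP] := cocircuit_orthogonal tameM indepE cP cb; exists d.
exists c, d; split=> [o co e oe|b cb|o b co cb].
- by have [_ ->] := cP o co.
- by case: (dP b cb).
- by case: (dP b cb) => _; apply.
Qed.
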